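(* Let $d,k\in\mathbb{N}$ and let $\mathbf{r}_1,\ldots,\mathbf{r}_k\in\operatorname{int}(\mathcal{D}_d)$ be such that $H:=\operatorname{conv}(\{\mathbf{r}_1,\ldots,\mathbf{r}_k\})\subset\operatorname{int}(\mathcal{D}_d)$. Consider the following algorithm (Algorithm 1) with input $(\mathbf{r}_1,\ldots,\mathbf{r}_k)$. Start with $\mathcal{P}:=\emptyset$. While $H\setminus\bigcup\mathcal{P}\neq\emptyset$: select an arbitrary $\mathbf{r}\in H\setminus\bigcup\mathcal{P}$, replace $\mathcal{P}$ by $\mathcal{P}\cup\{H\cap P_{\mathbf{r}}\}$, and set the flag $\mathrm{fin}_{H\cap P_{\mathbf{r}}}$ to true if $\mathbf{r}\in\mathcal{D}_d^{(0)}$ and to false otherwise (this is decided by computing the finite set $V_{\mathbf{r}}$ and checking whether every $\mathbf{a}\in V_{\mathbf{r}}$ satisfies $\tau_{\mathbf{r}}^n(\mathbf{a})=\mathbf{0}$ for some $n\in\mathbb{N}$). When the loop ends, return $\{P\in\mathcal{P}\mid \mathrm{fin}_P=\text{true}\}$. Then this algorithm terminates for all inputs; that is, for every such $(\mathbf{r}_1,\ldots,\mathbf{r}_k)$ and every choice of selections, the while loop ends after finitely many iterations.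
   Context: $\mathbb{N}$ is the set of positive integers, $\mathbb{N}_0=\mathbb{N}\cup\{0\}$. For $\mathbf{r}\in\mathbb{R}^d$ and $\mathbf{a}=(a_1,\ldots,a_d)\in\mathbb{Z}^d$, $\mathbf{r}\mathbf{a}$ denotes the standard inner product, and the shift radix system $\tau_{\mathbf{r}}:\mathbb{Z}^d\to\mathbb{Z}^d$ is $\tau_{\mathbf{r}}(\mathbf{a})=(a_2,\ldots,a_d,-\lfloor\mathbf{r}\mathbf{a}\rfloor)$. Put $\tau_{\mathbf{r}}^\star(\mathbf{a}):=-\tau_{\mathbf{r}}(-\mathbf{a})$. $\tau_{\mathbf{r}}^n$ denotes the $n$-fold iterate. Define $$\mathcal{D}_d:=\{\mathbf{r}\in\mathbb{R}^d\mid\forall\mathbf{a}\in\mathbb{Z}^d\ \exists m\neq n\in\mathbb{N}:\tau_{\mathbf{r}}^m(\mathbf{a})=\tau_{\mathbf{r}}^n(\mathbf{a})\},\qquad \mathcal{D}_d^{(0)}:=\{\mathbf{r}\in\mathbb{R}^d\mid\forall\mathbf{a}\in\mathbb{Z}^d\ \exists n\in\mathbb{N}:\tau_{\mathbf{r}}^n(\mathbf{a})=\mathbf{0}\}.$$ For $\mathbf{r}\in\mathbb{R}^d$ the set of witnesses $V_{\mathbf{r}}\subseteq\mathbb{Z}^d$ is $V_{\mathbf{r}}:=\bigcup_{n\in\mathbb{N}_0}V_n$, where $V_0:=\{(\pm1,0,\ldots,0),\ldots,(0,\ldots,0,\pm1)\}$ and $V_n:=V_{n-1}\cup\tau_{\mathbf{r}}(V_{n-1})\cup\tau_{\mathbf{r}}^\star(V_{n-1})$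 for $n\in\mathbb{N}$. (It is known that $V_{\mathbf{r}}$ is finite if $\mathbf{r}\in\operatorname{int}(\mathcal{D}_d)$, and that $\mathbf{r}\in\mathcal{D}_d^{(0)}$ iff every $\mathbf{a}\in V_{\mathbf{r}}$ satisfies $\tau_{\mathbf{r}}^n(\mathbf{a})=\mathbf{0}$ for some $n\in\mathbb{N}$.) Finally $$P_{\mathbf{r}}:=\{\mathbf{s}\in\mathbb{R}^d\mid\forall\mathbf{a}\in V_{\mathbf{r}}:\ \tau_{\mathbf{s}}(\mathbf{a})=\tau_{\mathbf{r}}(\mathbf{a})\ \wedge\ \tau_{\mathbf{s}}^\star(\mathbf{a})=\tau_{\mathbf{r}}^\star(\mathbf{a})\}.$$ *)

(* Defs.v *)
From HB Require Import structures.
From mathcomp Require Import all_boot all_order all_algebra.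
From mathcomp Require Import all_classical all_reals all_analysis.

Set Implicit Arguments.
Unset Strict Implicit.
Unset Printing Implicit Defensive.

Import Order.TTheory GRing.Theory Num.Theory.
Import numFieldNormedType.Exports.

Local Open Scope classical_set_scope.
Local Open Scope ring_scope.

Section ShiftRadixSystem.
Context {R : realType} {d : nat}.

Definition inner (r : 'rV[R]_d) (a : 'rV[int]_d) : R :=
  \sum_(i < d) r ord0 i * (a ord0 i)%:~R.

(* The coordinates a_2, ..., a_d are shifted down by one; the last index is the
   only i for which insub i.+1 : option 'I_d is None. *)
Definition srs (r : 'rV[R]_d) (a : 'rV[int]_d) : 'rV[int]_d :=
  \row_(i < d) if insub i.+1 is Some j then a ord0 j
               else - Num.floor (inner r a).

Definition srs_star (r : 'rV[R]_d) (a : 'rV[int]_d) : 'rV[int]_d :=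
  - srs r (- a).

Definition D : set 'rV[R]_d :=
  [set r | forall a : 'rV[int]_d, exists m n : nat,
     [/\ (0 < m)%N, (0 < n)%N, m <> n & iter m (srs r) a = iter n (srs r) a]].

Definition D0 : set 'rV[R]_d :=
  [set r | forall a : 'rV[int]_d, exists n : nat,
     (0 < n)%N /\ iter n (srs r) a = 0].

Fixpoint V_ (r : 'rV[R]_d) (n : nat) : set 'rV[int]_d :=
  match n with
  | 0%N => [set a | exists i : 'I_d,
                      a = delta_mx ord0 i \/ a = - delta_mx ord0 i]
  | n'.+1 => V_ r n' `|` (srs r @` V_ r n') `|` (srs_star r @` V_ r n')
  end.

Definition witnesses (r : 'rV[R]_d) : set 'rV[int]_d := \bigcup_n V_ r n.

Definition P_ (r : 'rV[R]_d) : set 'rV[R]_d :=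
  [set s | forall a, witnesses r a ->
     srs s a = srs r a /\ srs_star s a = srs_star r a].

Definition conv (A : set 'rV[R]_d) : set 'rV[R]_d :=
  smallest (@convex_set R ('rV[R]_d)) A.

End ShiftRadixSystem.

Arguments D R d : clear implicits.
Arguments D0 R d : clear implicits.

Section Algorithm.
Context {R : realType} {d : nat}.

(* fin assigns no flag (None) to a set until the algorithm has set one. *)
Record state := State {
  patches : set (set 'rV[R]_d);
  fin : set 'rV[R]_d -> option bool }.

Definition init_state : state := State set0 (fun=> None).

Definition uncovered (H : set 'rV[R]_d) (st : state) : set 'rV[R]_d :=
  H `\` \bigcup_(Q in patches st) Q.

Definition loop_body (H : set 'rV[R]_d) (st : state) (r : 'rV[R]_d) : state :=
  State (patches st `|` [set H `&` P_ r])
        (fun Q => if `[< Q = H `&` P_ r >] then Some `[< D0 R d r >]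
                  else fin st Q).

Fixpoint state_after (H : set 'rV[R]_d) (sel : nat -> 'rV[R]_d) (n : nat) :
    state :=
  if n is n'.+1 then loop_body H (state_after H sel n') (sel n')
  else init_state.

(* sel n is the point selected in iteration n; it is unconstrained once the
   loop condition fails, so every sequence of selections, including adaptive
   ones, is covered. *)
Definition valid_selections (H : set 'rV[R]_d) (sel : nat -> 'rV[R]_d) : Prop :=
  forall n, uncovered H (state_after H sel n) !=set0 ->
    uncovered H (state_after H sel n) (sel n).

Definition loop_ends_after (H : set 'rV[R]_d) (sel : nat -> 'rV[R]_d)
    (n : nat) : Prop :=
  (forall m, (m < n)%N -> uncovered H (state_after H sel m) !=set0) /\
  uncovered H (state_after H sel n) = set0.

Definition hull k (rs : 'I_k -> 'rV[R]_d) : set 'rV[R]_d := conv (range rs).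

Definition algorithm_returns k (rs : 'I_k -> 'rV[R]_d)
    (sel : nat -> 'rV[R]_d) (n : nat) (out : set (set 'rV[R]_d)) : Prop :=
  loop_ends_after (hull rs) sel n /\
  out = [set Q | patches (state_after (hull rs) sel n) Q /\
                 fin (state_after (hull rs) sel n) Q = Some true].

End Algorithm.

(* Main.v *)
Require Import Defs.
From HB Require Import structures.
From mathcomp Require Import all_boot all_order all_algebra.
From mathcomp Require Import all_classical all_reals all_analysis.
From mathcomp Require Import complex ring lra zify.

(** Every iteration selects a point outside the patches collected so far and
adds a patch containing that point, so an infinite run would produce
infinitely many different sets [H `&` P_ s] with [s] in [H].  It therefore
suffices that only finitely many such sets exist ([loop_terminates]).  The set
[P_ s] depends only on the set of witnesses of [s] and on the restrictions of
[srs s] and [srs_star s] to it, and both maps send witnesses to witnesses.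
Hence, if one box contains the witnesses of all [s] in [H], these data form a
relation on a finite set, for which there are finitely many possibilities
([finite_P_]).  What remains is to bound the witnesses uniformly over [H].

Both [srs s] and [srs_star s] act as the companion matrix of the polynomial
[charp s], that is, X^d + s_(d-1) X^(d-1) + ... + s_0, up to an error of
absolute value at most 1 in the last coordinate.  A polynomial q of degree
less than d is used as the linear functional [pairing q] on Z^d, with its
coefficients as weights; one step of the dynamics amounts to multiplying q by
X modulo [charp s].  This makes linear factors of [charp s] do the work of
eigenvectors and Jordan chains.

- If [s] is in [D] and z is a root of [charp s], then |z| <= 1
  ([normc_root_D]): for q = charp s / (X - z) the value [pairing q a] is
  multiplied by z at each step, up to an error at most 1, so for |z| > 1 it
  grows strictly along the orbit of a suitable starting point, and that orbit
  cannot be eventually periodic.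
- If [s] ranges over a compact subset of the interior of [D], then for some
  mu > 1 all parameters obtained by multiplying the roots by mu are still in
  [D], so all roots have modulus at most rho = 1/mu < 1
  ([compact_interior_D_gap]).
- Writing [charp s] as a product of factors X - z, the functionals given by
  the partial products satisfy a triangular system of contractions with ratio
  rho, which keeps explicit bounds invariant; these hold for the unit vectors
  and hence for all witnesses ([witnesses_bounded]), with constants depending
  on d and rho only.

Finally [H], the convex hull of finitely many points, is compact, being
obtained by repeatedly joining a point to a compact convex set
([hull_compact]). *)

Set Implicit Arguments.
Unset Strict Implicit.
Unset Printing Implicit Defensive.

Import Order.TTheory GRing.Theory Num.Theory.
Import numFieldNormedType.Exports.
Import ComplexField.Normc.

Local Open Scope classical_set_scope.
Local Open Scope ring_scope.
Local Open Scope complex_scope.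

(** * The characteristic polynomial and its action on functionals *)

Lemma normc_real (R : realType) (x : R) : normc x%:C = `|x|.
Proof. by rewrite /= expr0n addr0 sqrtr_sqr. Qed.

Lemma normc_ge0 (R : realType) (z : R[i]) : 0 <= normc z.
Proof. by case: z => x y /=; exact: sqrtr_ge0. Qed.

Lemma real_complex_int (R : realType) (m : int) :
  (m%:~R : R)%:C = m%:~R :> R[i].
Proof. exact: (rmorph_int (real_complex R)). Qed.

Section CharacteristicPolynomial.
Variables (R : realType) (n : nat).
Implicit Types (s : 'rV[R]_n.+1) (a b : 'rV[int]_n.+1) (q : {poly R[i]}).

Definition charp s : {poly R[i]} :=
  'X^(n.+1) + \poly_(i < n.+1) (s ord0 (inord i))%:C.

Lemma charp_coef s (i : 'I_n.+1) : (charp s)`_i = (s ord0 i)%:C.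
Proof.
by rewrite coefD coefXn coef_poly ltn_ord inord_val ltn_eqF ?add0r.
Qed.

Lemma size_charp s : size (charp s) = n.+2.
Proof. by rewrite /charp size_polyDl size_polyXn// ltnS size_poly. Qed.

Lemma charp_monic s : charp s \is monic.
Proof.
by rewrite monicE lead_coefDl ?lead_coefXn// size_polyXn ltnS size_poly.
Qed.

Lemma horner_charp s (z : R[i]) :
  (charp s).[z] = z ^+ n.+1 + \sum_(i < n.+1) (s ord0 i)%:C * z ^+ i.
Proof.
rewrite hornerD hornerXn horner_poly; congr (_ + _).
by apply: eq_bigr => i _; rewrite inord_val.
Qed.

(** A polynomial as a linear functional; only its coefficients of degree at
most [n] count. *)
Definition pairing q a : R[i] := \sum_(i < n.+1) q`_i * (a ord0 i)%:~R.

Lemma pairingD q r a : pairing (q + r) a = pairing q a + pairing r a.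
Proof.
by rewrite -big_split; apply: eq_bigr => i _; rewrite coefD mulrDl.
Qed.

Lemma pairingZ c q a : pairing (c *: q) a = c * pairing q a.
Proof.
by rewrite big_distrr; apply: eq_bigr => i _; rewrite coefZ/= mulrA.
Qed.

Lemma pairing_delta q i : pairing q (delta_mx ord0 i) = q`_i.
Proof.
rewrite /pairing (bigD1 i)//= mxE !eqxx mulr1 big1 ?addr0// => j ji.
by rewrite mxE (negbTE ji) andbF mulr0.
Qed.

Lemma pairingN q a : pairing q (- a) = - pairing q a.
Proof.
by rewrite -sumrN; apply: eq_bigr => i _; rewrite mxE rmorphN mulrN.
Qed.

Lemma pairingMn q a m : pairing q (a *+ m) = pairing q a *+ m.
Proof.
by rewrite -sumrMnl; apply: eq_bigr => i _; rewrite mulmxnE rmorphMn mulrnAr.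
Qed.

Lemma pairingXn (i : 'I_n.+1) a : pairing 'X^i a = (a ord0 i)%:~R.
Proof.
rewrite /pairing (bigD1 i)//= coefXn eqxx mul1r big1 ?addr0// => j ji.
by rewrite coefXn -val_eqE/= in ji *; rewrite (negbTE ji) mul0r.
Qed.

Lemma pairing_charp s a : pairing (charp s) a = (inner s a)%:C.
Proof.
rewrite rmorph_sum; apply: eq_bigr => i _.
by rewrite charp_coef rmorphM/= real_complex_int.
Qed.

(** [b] is the image of [a] under the companion matrix of [charp s], with an
error [e] in the last coordinate; phrased through functionals so that it can be
used directly with any polynomial.  Since [pairing] ignores the coefficients
from degree [n.+1] on, [pairing (charp s) a] is the inner product of [s] and
[a], and for [q] of degree [n] the right-hand side pairs [a] with the remainder
of X q modulo [charp s]. *)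
Definition companion_step s a b := exists2 e : R, `|e| <= 1 &
  forall q, pairing q b =
    pairing ('X * q) a + q`_n * (e%:C - pairing (charp s) a).

(** The error is the fractional part of the inner product. *)
Lemma srs_step s a : companion_step s a (srs s a).
Proof.
exists (inner s a - (Num.floor (inner s a))%:~R).
  rewrite ger0_norm ?subr_ge0 ?floor_le//.
  by have := ltW (floorD1_gt (inner s a)); rewrite rmorphD lerBlDl.
move=> q; rewrite pairing_charp rmorphB/= addrAC subrr add0r.
rewrite real_complex_int /pairing big_ord_recr [in RHS]big_ord_recl/=.
rewrite coefXM mul0r add0r; congr (_ + _).
  apply: eq_bigr => i _; rewrite mxE coefXM/=; case: insubP => [j _ ij|].
    by congr (_ * (a _ _)%:~R); apply: val_inj; rewrite /= ij.
  by rewrite ltnS ltn_ord.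
rewrite mxE; case: insubP => [j /=|_]; first by rewrite ltnn.
by rewrite rmorphN.
Qed.

Lemma srs_star_step s a : companion_step s a (srs_star s a).
Proof.
have [e e1 H] := srs_step s (- a).
exists (- e) => [|q]; first by rewrite normrN.
rewrite pairingN H !pairingN rmorphN/= opprD opprK -mulrN opprD.
by rewrite opprK.
Qed.

(** Below the top degree no reduction modulo [charp s] occurs and the step is
exact: X q = z q + (X - z) q. *)
Lemma pairing_step s a b : companion_step s a b -> forall q (z : R[i]),
  (size q <= n)%N ->
  pairing q b = z * pairing q a + pairing (q * ('X - z%:P)) a.
Proof.
move=> [e _ H] q z sq; rewrite H nth_default// mul0r addr0 -pairingZ -pairingD.
by rewrite mulrBr [q * z%:P]mulrC mul_polyC addrC subrK mulrC.
Qed.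

Lemma charp_cofactor_lead s q (z : R[i]) : charp s = q * ('X - z%:P) ->
  q`_n = 1.
Proof.
move=> Hs; have q0 : q != 0.
  apply: contraTneq (charp_monic s) => q0.
  by rewrite Hs q0 mul0r monicE lead_coef0 eq_sym oner_eq0.
have sq : size q = n.+1.
  have := size_charp s; rewrite Hs size_Mmonic ?monicXsubC// size_XsubC addn2/=.
  by move=> [].
have := charp_monic s.
by rewrite Hs monicMr ?monicXsubC// monicE /lead_coef sq => /eqP.
Qed.

(** The cofactor of a root [z] is a left eigenvector for [z] of the companion
matrix: X q = z q + charp s.  The error has weight 1 because [q] is monic. *)
Lemma pairing_step_cofactor s a b : companion_step s a b ->
  exists2 e : R, `|e| <= 1 &
  forall q (z : R[i]), charp s = q * ('X - z%:P) ->
  pairing q b = z * pairing q a + e%:C.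
Proof.
move=> [e e1 H]; exists e => // q z Hs.
have q1 := charp_cofactor_lead Hs.
rewrite H q1 mul1r Hs addrCA addrC; congr (_ + _).
rewrite -pairingZ; apply/eqP; rewrite subr_eq -pairingD.
apply/eqP; congr pairing.
by rewrite mulrBr mulrC [q * z%:P]mulrC mul_polyC addrC subrK.
Qed.

End CharacteristicPolynomial.

(** * Roots of the characteristic polynomial for parameters in D *)

Section RootsOfD.
Variables (R : realType) (n : nat).
Implicit Types (s : 'rV[R]_n.+1) (a b : 'rV[int]_n.+1) (z : R[i]).

Lemma incr_iter_inj (T : Type) (f : T -> T) (h : T -> R) (x : T) :
  (forall m, h (iter m f x) < h (iter m.+1 f x)) ->
  injective (fun m => iter m f x).
Proof.
move=> hf; have mono i j : (i < j)%N -> h (iter i f x) < h (iter j f x).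
  move=> /subnKC <-; elim: (j - i.+1)%N => [|m IHm]; first by rewrite addn0.
  by apply: lt_trans IHm _; rewrite addnS.
move=> i j /= ij; have [/mono|/mono|//] := ltngtP i j.
  by rewrite ij ltxx.
by rewrite ij ltxx.
Qed.

(** A root of modulus greater than 1 makes the functional of its cofactor grow
strictly along some orbit, while every orbit of [srs s] revisits a point. *)
Lemma normc_root_D s z : D R n.+1 s -> root (charp s) z -> normc z <= 1.
Proof.
move=> Ds /factor_theorem[q Hq]; have q1 := charp_cofactor_lead Hq.
rewrite leNgt; apply/negP => z1.
pose h (a : 'rV[int]_n.+1) : R := normc (pairing q a).
(* Starting value large enough for the expansion to beat the error 1. *)
pose N := Num.bound ((normc z - 1)^-1).
pose a0 : 'rV[int]_n.+1 := delta_mx ord0 ord_max *+ N.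
have ha0 : 1 < (normc z - 1) * h a0.
  rewrite /h pairingMn pairing_delta q1 normcMn normc1 mulrC.
  rewrite -ltr_pdivrMr ?subr_gt0// div1r.
  by rewrite archi_boundP// invr_ge0 subr_ge0 ltW.
have hS a : normc z * h a - 1 <= h (srs s a).
  have [e e1 /(_ q z Hq) E] := pairing_step_cofactor (srs_step s a).
  have -> : normc z * h a = normc (pairing q (srs s a) + (- e%:C)).
    by rewrite E addrK normcM.
  rewrite lerBlDr; apply: le_trans (le_normcD _ _) _.
  by rewrite lerD2l normcN normc_real.
have hlt a : 1 < (normc z - 1) * h a -> h a < h (srs s a).
  by move=> ha; apply: lt_le_trans (hS a); lra.
have hinv m : 1 < (normc z - 1) * h (iter m (srs s) a0).
  elim: m => // m IHm; apply: (lt_trans IHm) => /=.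
  by rewrite ltr_pM2l ?subr_gt0//; exact: hlt.
have [i [j [_ _ ij]]] := Ds a0.
by move/(@incr_iter_inj _ (srs s) h a0 (fun m => hlt _ (hinv m))).
Qed.

(** The coefficient of degree i is multiplied by mu^(d - i), which multiplies
all roots of [charp s] by [mu]. *)
Definition scale_roots (mu : R) s : 'rV[R]_n.+1 :=
  \row_i (s ord0 i * mu ^+ (n.+1 - i)).

Lemma root_scale_roots mu s z :
  root (charp s) z -> root (charp (scale_roots mu s)) (mu%:C * z).
Proof.
move=> /rootP sz; apply/rootP.
rewrite -(mulr0 (mu%:C ^+ n.+1)) -sz !horner_charp mulrDr exprMn; congr (_ + _).
rewrite big_distrr; apply: eq_bigr => i _ /=.
have -> : mu%:C ^+ n.+1 = mu%:C ^+ (n.+1 - i) * mu%:C ^+ i.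
  by rewrite -exprD subnK// ltnW.
by rewrite mxE rmorphM rmorphXn exprMn /=; ring.
Qed.

Lemma normc_root_scale_D mu s z : 1 < mu -> D R n.+1 (scale_roots mu s) ->
  root (charp s) z -> normc z <= mu^-1.
Proof.
move=> mu1 Ds /(root_scale_roots mu)/(normc_root_D Ds).
have mu0 : 0 < mu by rewrite (lt_trans _ mu1).
by rewrite normcM normc_real gtr0_norm// mulrC -ler_pdivlMr// div1r.
Qed.

Lemma scale_roots_continuous :
  continuous (fun x : R * 'rV[R]_n.+1 => scale_roots x.1 x.2).
Proof.
move=> x.
have E y : scale_roots y.1 y.2 =
    \sum_i (y.2 ord0 i * y.1 ^+ (n.+1 - i)) *: delta_mx ord0 i.
  by rewrite [LHS]row_sum_delta; apply: eq_bigr => i _; rewrite mxE.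
rewrite /continuous_at E; under eq_fun do rewrite E.
apply: cvg_big => [|i _]; first exact: add_continuous.
apply: cvgZr_tmp; apply: cvgM.
  apply: (@cvg_comp _ _ _ snd (fun t : 'rV[R]_n.+1 => t ord0 i)
    _ (nbhs x.2)); first exact: cvg_snd.
  exact: coord_continuous.
apply: (@cvg_comp _ _ _ fst (fun t => t ^+ (n.+1 - i)) _ (nbhs x.1)).
  exact: cvg_fst.
exact: exprn_continuous.
Qed.

(** By compactness one factor [mu] > 1 works for all of [K]: near each [s] in
[K] and for [mu] near 1 the scaled parameter is still in [D], and its roots,
which are those of [charp s] times [mu], have modulus at most 1. *)
Lemma compact_interior_D_gap (K : set 'rV[R]_n.+1) :
  compact K -> K `<=` interior (D R n.+1) ->
  exists2 rho : R, 0 < rho < 1 &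
    forall s z, K s -> root (charp s) z -> normc z <= rho.
Proof.
move=> /compact_near_coveringP cK KD.
have : \forall mu \near (1 : R)^'+,
    K `<=` [set s | D R n.+1 (scale_roots mu s)].
  apply: cK => s Ks.
  have s1 : scale_roots 1 s = s by apply/rowP => i; rewrite mxE expr1n mulr1.
  have := @scale_roots_continuous (1, s) (D R n.+1).
  rewrite /= s1 => /(_ (KD _ Ks)).
  move=> [[U V] /= [nU nV] UV]; exists (V, U) => /=.
    by split=> //; exact: cvg_within nU.
  move=> [s' mu] /= [Vs' Umu]; exact: (UV (mu, s')).
move=> near_D; near (1 : R)^'+ => mu.
have mu1 : 1 < mu by near: mu; exact: nbhs_right_gt.
have KmuD : K `<=` [set s | D R n.+1 (scale_roots mu s)] by near: mu.
exists mu^-1 => [|s z Ks].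
  by rewrite invr_gt0 invf_lt1 ?(lt_trans ltr01)// mu1.
exact/normc_root_scale_D/KmuD.
Unshelve. all: by end_near.
Qed.

End RootsOfD.

(** * A uniform bound for the witnesses *)

Section Contraction.
Variables (R : realType) (n : nat).
Implicit Types (l : seq R[i]).

Definition rprod l : {poly R[i]} := \prod_(z <- l) ('X - z%:P).

Lemma rprod_rcons l z : rprod (rcons l z) = rprod l * ('X - z%:P).
Proof. by rewrite /rprod -cats1 big_cat big_seq1. Qed.

Lemma normc_coef_rprod l i : {in l, forall z, normc z <= 1} ->
  normc ((rprod l)`_i) <= 2 ^+ size l.
Proof.
elim: l i => [|z l IHl] i zl.
  rewrite /rprod big_nil expr0 coef1; case: eqP => _; rewrite ?normc1//.
  by rewrite normc0 ler01.
have {}IHl j : normc ((rprod l)`_j) <= 2 ^+ size l.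
  by apply: IHl => y yl; apply: zl; rewrite inE yl orbT.
rewrite /rprod big_cons -/(rprod l) mulrBl coefB coefXM coefCM /= exprS.
rewrite mulr_natl mulr2n; apply: le_trans (le_normcD _ _) _; apply: lerD.
  by case: ifP => _; rewrite ?normc0 ?exprn_ge0.
by rewrite normcN normcM -[leRHS]mul1r ler_pM ?normc_ge0 ?zl ?mem_head.
Qed.

Variables (s : 'rV[R]_n.+1) (l : seq R[i]) (rho : R).
Hypotheses (sl : charp s = rprod l) (rho01 : 0 < rho < 1)
  (l_rho : {in l, forall z, normc z <= rho}).

(* K is chosen so that rho K + 1 = K, which makes the bounds of [tame]
   reproduce themselves under one step; M dominates the coefficients of all
   partial products. *)
Let K := (1 - rho)^-1.
Let M : R := 2 ^+ n.+1.

Let K_ge1 : 1 <= K.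
Proof. by case/andP: rho01 => r0 r1; rewrite /K invf_ge1; lra. Qed.

Let K_fix : rho * K + 1 = K.
Proof. by case/andP: rho01 => r0 r1; rewrite /K; field; lra. Qed.

Let M_ge1 : 1 <= M.
Proof. by rewrite /M exprn_ege1// ler1n. Qed.

Let size_l : size l = n.+1.
Proof.
by have := size_charp s; rewrite sl size_prod_XsubC => -[].
Qed.

(** Bounds on the functionals given by the partial products of [charp s].
One step multiplies the functional of [l1] by [z] and adds that of
[rcons l1 z], so the bounds shrink by a factor [K] along the chain and are
preserved by every step. *)
Definition tame (a : 'rV[int]_n.+1) := forall l1 z l2, l = l1 ++ z :: l2 ->
  normc (pairing (rprod l1) a) <= M * K ^+ (size l2).+1.

Lemma tame_step a b : companion_step s a b -> tame a -> tame b.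
Proof.
move=> ab ta l1 z l2 El.
have Ez : rprod l1 * ('X - z%:P) = rprod (rcons l1 z) by rewrite rprod_rcons.
(* The remainder r is the next functional of the chain at a, or the rounding
   error when the factors are exhausted. *)
have [r Hr r_le] : exists2 r,
    pairing (rprod l1) b = z * pairing (rprod l1) a + r &
    normc r <= M * K ^+ size l2.
  case: l2 => [|y l2] in El *.
    have [e e1 He] := pairing_step_cofactor ab.
    exists e%:C; first by apply: He; rewrite Ez sl El cats1.
    by rewrite normc_real mulr1; exact: le_trans M_ge1.
  exists (pairing (rprod (rcons l1 z)) a).
    rewrite -Ez; apply: (pairing_step ab).
    rewrite size_prod_XsubC; have := size_l; rewrite El size_cat/=.
    by rewrite !addnS => -[<-]; rewrite ltnS leq_addr.
  by apply: ta; rewrite El cat_rcons.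
rewrite Hr; apply: le_trans (le_normcD _ _) _; rewrite normcM.
have -> : M * K ^+ (size l2).+1 =
    rho * (M * K ^+ (size l2).+1) + M * K ^+ size l2.
  by rewrite !exprS -{1}K_fix; ring.
apply: lerD => //; apply: ler_pM; rewrite ?normc_ge0//.
  by apply: l_rho; rewrite El mem_cat mem_head orbT.
exact: ta El.
Qed.

Lemma tame_delta i : tame (delta_mx ord0 i).
Proof.
move=> l1 z l2 El; rewrite pairing_delta.
apply: le_trans (normc_coef_rprod _ _) _ => [y yl1|].
  case/andP: rho01 => _ /ltW; apply: le_trans; apply: l_rho.
  by rewrite El mem_cat yl1.
rewrite -[leLHS]mulr1 ler_pM ?exprn_ge0 ?exprn_ege1//.
by rewrite ler_weXn2l ?ler1n// -size_l El size_cat leq_addr.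
Qed.

Lemma tameN a : tame a -> tame (- a).
Proof. by move=> ta l1 z l2 /ta; rewrite pairingN normcN. Qed.

Lemma tame_witness a : witnesses s a -> tame a.
Proof.
case=> m _; elim: m a => [|m IHm] a /=.
  by case=> i [|] ->; [|apply: tameN]; exact: tame_delta.
move=> [[/IHm//|]|] [b /IHm tb <-].
  exact: tame_step (srs_step s b) tb.
exact: tame_step (srs_star_step s b) tb.
Qed.

(** The monomials X^i are recovered from the partial products by
X^(i+1) q = X^i (X - z) q + z X^i q; with [l1] empty this bounds the coordinates
of [a]. *)
Lemma tame_shift a : tame a -> forall i l1 l2, l = l1 ++ l2 ->
  (i + size l1 <= n)%N ->
  normc (pairing ('X^i * rprod l1) a) <= 2 ^+ i * (M * K ^+ n.+1).
Proof.
move=> ta; elim=> [|i IHi] l1 [|z l2] El.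
- by rewrite cats0 in El; rewrite -El size_l add0n ltnn.
- move=> _; rewrite expr0 !mul1r; apply: le_trans (ta _ _ _ El) _.
  rewrite ler_wpM2l ?(le_trans ler01 M_ge1)// ler_weXn2l//.
  by rewrite -size_l El size_cat/= leq_addl.
- by rewrite cats0 in El; rewrite -El size_l addnS ltnNge leq_addl.
- move=> il1.
  have -> : 'X^(i.+1) * rprod l1 =
      'X^i * rprod (rcons l1 z) + z *: ('X^i * rprod l1).
    by rewrite rprod_rcons exprSr -mul_polyC; ring.
  rewrite pairingD pairingZ; apply: le_trans (le_normcD _ _) _.
  rewrite exprS -mulrA mulr_natl mulr2n; apply: lerD.
    by apply: (IHi _ l2); rewrite ?cat_rcons// size_rcons addnS.
  rewrite normcM -[leRHS]mul1r ler_pM ?normc_ge0//; last first.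
    by apply: IHi El _; rewrite ltnW.
  case/andP: rho01 => _ /ltW; apply: le_trans; apply: l_rho.
  by rewrite El mem_cat mem_head orbT.
Qed.

Lemma tame_bounded a : tame a ->
  forall i, (`|a ord0 i|%:~R : R) <=
    2 ^+ n * (2 ^+ n.+1 * (1 - rho)^-1 ^+ n.+1).
Proof.
move=> ta i.
have := tame_shift ta (i := i) (l1 := [::]) (l2 := l) erefl.
rewrite addn0 -ltnS ltn_ord /rprod big_nil mulr1 pairingXn => /(_ isT).
rewrite -real_complex_int normc_real intr_norm => /le_trans; apply.
rewrite ler_wpM2r ?ler_weXn2l ?ler1n -1?ltnS//.
by rewrite mulr_ge0 ?exprn_ge0 ?(le_trans ler01 K_ge1).
Qed.

End Contraction.

Lemma witnesses_bounded (R : realType) (n : nat) (s : 'rV[R]_n.+1) (rho : R) a :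
  0 < rho < 1 -> (forall z, root (charp s) z -> normc z <= rho) ->
  witnesses s a -> forall i,
  (`|a ord0 i|%:~R : R) <= 2 ^+ n * (2 ^+ n.+1 * (1 - rho)^-1 ^+ n.+1).
Proof.
move=> rho01 s_rho sa; have [l] := closed_field_poly_normal (charp s).
rewrite (monicP (charp_monic s)) scale1r => sl.
have l_rho : {in l, forall z, normc z <= rho}.
  by move=> z zl; apply: s_rho; rewrite sl root_prod_XsubC.
exact: tame_bounded sl rho01 l_rho _ (tame_witness sl rho01 l_rho sa).
Qed.

(** * Compactness of the convex hull of finitely many points *)

Section Convexity.
Variables (R : realType) (d : nat).
Implicit Types (A K : set 'rV[R]_d) (x y : 'rV[R]_d).

Lemma convex_setP A : convex_set A <-> forall x y (t : R),
  0 <= t <= 1 -> A x -> A y -> A (t *: x + (1 - t) *: y).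
Proof.
split=> [cA x y t /andP[t0 t1] Ax Ay|cA x y t].
  by have := cA x y (Itv01 t0 t1); rewrite !inE; apply.
by rewrite !inE; apply: cA; rewrite ge0 le1.
Qed.

Definition join_point x K : set 'rV[R]_d :=
  (fun ty : R * 'rV[R]_d => ty.1 *: x + (1 - ty.1) *: ty.2) @`
    (`[0, 1]%classic `*` K).

Lemma join_point_compact x K : compact K -> compact (join_point x K).
Proof.
move=> cK; apply: continuous_compact; last first.
  by apply: compact_setX => //; exact: segment_compact.
apply: continuous_subspaceT => -[t y].
apply: cvgD; apply: cvgZ.
- exact: cvg_fst.
- exact: cvg_cst.
- by apply: cvgB; [exact: cvg_cst|exact: cvg_fst].
- exact: cvg_snd.
Qed.

(** A convex combination of points on the segments from [x] to [y] and from [x]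
to [w] lies on a segment from [x] to a point between [y] and [w]. *)
Lemma join_point_convex x K : convex_set K -> convex_set (join_point x K).
Proof.
rewrite !convex_setP => cK _ _ t /andP[t0 t1] [[a y] /= [a01 Ky] <-]
  [[b w] /= [b01 Kw] <-].
move: a01 b01; rewrite /= !in_itv/= => /andP[a0 a1] /andP[b0 b1].
(* u and v are the weights of y and w; x gets the rest. *)
pose u := t * (1 - a); pose v := (1 - t) * (1 - b).
have u0 : 0 <= u by rewrite mulr_ge0; lra.
have v0 : 0 <= v by rewrite mulr_ge0; lra.
have [uv0|uv_neq0] := eqVneq (u + v) 0.
  have [u_eq0 v_eq0] : u = 0 /\ v = 0 by lra.
  exists (1, y); first by split=> //=; rewrite in_itv/= ler01 lexx.
  apply/rowP => i; rewrite !mxE /=.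
  transitivity
    (x ord0 i + u * (y ord0 i - x ord0 i) + v * (w ord0 i - x ord0 i)).
    by rewrite u_eq0 v_eq0; ring.
  by rewrite /u /v; ring.
have uv_gt0 : 0 < u + v by rewrite lt_neqAle eq_sym uv_neq0 addr_ge0.
exists (1 - (u + v), (u / (u + v)) *: y + (1 - u / (u + v)) *: w).
  split=> /=; first by rewrite in_itv/= /u /v; apply/andP; split; nra.
  apply: cK => //; apply/andP; split; first by rewrite divr_ge0// ltW.
  by rewrite ler_pdivrMr// mul1r lerDl.
apply/rowP => i; rewrite !mxE /=.
transitivity ((1 - (u + v)) * x ord0 i + u * y ord0 i + v * w ord0 i).
  by field.
by rewrite /u /v; ring.
Qed.

Lemma conv_convex A : convex_set (Defs.conv A).
Proof.
apply/convex_setP => x y t t01 xA yA C [cC AC].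
by apply: (convex_setP C).1 => //; [exact: xA|exact: yA].
Qed.

Lemma sub_conv A : A `<=` Defs.conv A.
Proof. exact: sub_smallest. Qed.

Lemma conv_min A C : convex_set C -> A `<=` C -> Defs.conv A `<=` C.
Proof. by move=> cC AC; apply: smallest_sub. Qed.

Lemma conv_set1 x : Defs.conv [set x] = [set x].
Proof.
apply/seteqP; split; last exact: sub_conv.
apply: conv_min => //; apply/convex_setP => y z t _ -> -> /=.
by rewrite -scalerDl addrC subrK scale1r.
Qed.

Lemma conv_setU1 x A : A !=set0 ->
  Defs.conv (x |` A) = join_point x (Defs.conv A).
Proof.
move=> [y Ay]; apply/seteqP; split.
  apply: conv_min; first exact/join_point_convex/conv_convex.
  move=> z [->|Az].
    exists (1, y); last by rewrite /= subrr scale0r addr0 scale1r.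
    by split; [rewrite /= in_itv/= ler01 lexx|exact: sub_conv].
  exists (0, z); last by rewrite /= subr0 scale0r add0r scale1r.
  by split; [rewrite /= in_itv/= ler01 lexx|exact: sub_conv].
move=> _ [[t z] [/= t01 Az] <-].
apply: (convex_setP (Defs.conv (x |` A))).1 => //; first exact: conv_convex.
  by apply: sub_conv; left.
apply: conv_min Az; first exact: conv_convex.
by move=> w Aw; apply: sub_conv; right.
Qed.

Lemma conv_seq_compact x (s : seq 'rV[R]_d) : compact (Defs.conv [set` x :: s]).
Proof.
elim: s x => [|y s IHs] x.
  by rewrite set_cons1 conv_set1; exact: compact_set1.
have -> : [set` [:: x, y & s]] = x |` [set` y :: s].
  by apply/seteqP; split=> z; rewrite /= (in_cons x) => /predU1P.
rewrite conv_setU1; first exact/join_point_compact/IHs.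
by exists y; rewrite /= mem_head.
Qed.

Lemma hull_compact k (rs : 'I_k -> 'rV[R]_d) : (0 < k)%N -> compact (hull rs).
Proof.
case: k rs => // k rs _.
have -> : hull rs = Defs.conv [set` codom rs].
  congr Defs.conv; apply/seteqP; split=> [_ [i _ <-]|x]; first exact: codom_f.
  by move=> /codomP[i ->]; exists i.
rewrite codomE enum_ordSl /=; exact: conv_seq_compact.
Qed.

End Convexity.

(** * Finitely many patches, and termination *)

Section Finiteness.
Variables (R : realType) (d : nat).

Lemma witness_srs (s : 'rV[R]_d) a :
  witnesses s a -> witnesses s (srs s a) /\ witnesses s (srs_star s a).
Proof.
move=> [m _ Va]; split; exists m.+1 => //=; first by left; right; exists a.
by right; exists a.
Qed.

(** Enumerates the integer points with all coordinates in [-N, N]. *)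
Definition box_point N (x : {ffun 'I_d -> 'I_N.*2.+1}) : 'rV[int]_d :=
  \row_i (x i)%:Z - const_mx N%:Z.

Lemma box_pointP N (a : 'rV[int]_d) : (forall i, `|a ord0 i| <= N%:Z) ->
  exists x, box_point (N := N) x = a.
Proof.
move=> aN; exists [ffun i => inord (absz (a ord0 i + N%:Z))].
apply/rowP => i; rewrite !mxE ffunE.
move: (aN i); rewrite ler_norml => /andP[l u].
have p : 0 <= a ord0 i + N%:Z by lia.
rewrite inordK; first by rewrite gez0_abs// addrK.
by rewrite -ltz_nat gez0_abs//; lia.
Qed.

(** [P_ s] is determined by the joint graph of [srs s] and [srs_star s] on the
witnesses, which is a subset of a finite set of triples of points of the box;
the values are again witnesses, so they lie in the box too. *)
Lemma finite_P_ N : finite_set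
  [set P_ s | s in [set s : 'rV[R]_d |
    forall a, witnesses s a -> forall i, `|a ord0 i| <= N%:Z]].
Proof.
pose T := {ffun 'I_d -> 'I_N.*2.+1}.
pose F (g : {set T * T * T}) : set 'rV[R]_d :=
  [set t | forall x y z, (x, y, z) \in g ->
     srs t (box_point x) = box_point y /\
     srs_star t (box_point x) = box_point z].
apply: (@sub_finite_set _ _ (range F)); last exact: finite_image.
move=> _ [s sN <-]; pose G := [set p : T * T * T |
  `[< [/\ witnesses s (box_point p.1.1),
          srs s (box_point p.1.1) = box_point p.1.2 &
          srs_star s (box_point p.1.1) = box_point p.2] >]]%SET.
exists G => //; apply/seteqP; split=> t /=.
  move=> Gt a sa; have [s1 s2] := witness_srs sa.
  have [x xE] := box_pointP (sN _ sa).
  have [y yE] := box_pointP (sN _ s1).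
  have [z zE] := box_pointP (sN _ s2).
  have := Gt x y z; rewrite xE yE zE; apply.
  by rewrite inE; apply/asboolP; rewrite /= xE yE zE.
move=> Pt x y z; rewrite inE => /asboolP[/= sx <- <-]; exact: Pt.
Qed.

Lemma patches_selected H (sel : nat -> 'rV[R]_d) m n : (m < n)%N ->
  patches (state_after H sel n) (H `&` P_ (sel m)).
Proof.
elim: n => // n IHn; rewrite ltnS leq_eqVlt => /predU1P[->|/IHn].
  by right.
by left.
Qed.

(** In an infinite run the patches of different iterations differ: the later
selected point lies in its own patch and in none of the earlier ones. *)
Lemma loop_terminates H (sel : nat -> 'rV[R]_d) :
  finite_set [set H `&` P_ s | s in H] -> valid_selections H sel ->
  exists n, loop_ends_after H sel n.
Proof.
move=> finP valid.
have [|never] := pselect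
    (exists n, `[< uncovered H (state_after H sel n) = set0 >]).
  move=> ex; have [n /asboolP ends nmin] := ex_minnP ex.
  exists n; split=> // m mn; apply/set0P/eqP => m0.
  by have := nmin m (asboolT m0); rewrite leqNgt mn.
have selP n : uncovered H (state_after H sel n) (sel n).
  apply: valid; apply/set0P/eqP => n0; apply: never; exists n; exact/asboolP.
have self s : H s -> (H `&` P_ s) s by move=> Hs; split=> // a _.
have new i j : (i < j)%N -> H `&` P_ (sel i) <> H `&` P_ (sel j).
  move=> ij E; have [Hj] := selP j; apply.
  exists (H `&` P_ (sel i)); first exact: patches_selected.
  by rewrite E; exact: self.
exfalso; apply: infinite_nat.
apply: sub_finite_set (finite_preimage _ finP (f := fun n => H `&` P_ (sel n))).
  by move=> n _; exists (sel n) => //; have [] := selP n.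
move=> i j _ _ ij; have [/new|/new|//] := ltngtP i j.
  by rewrite ij.
by rewrite ij.
Qed.

End Finiteness.

Theorem theorem3p2 (R : realType) (d k : nat) (hd : (0 < d)%N) (hk : (0 < k)%N)
    (rs : 'I_k -> 'rV[R]_d)
    (hrs : forall i, interior (D R d) (rs i))
    (hH : hull rs `<=` interior (D R d))
    (sel : nat -> 'rV[R]_d)
    (hsel : valid_selections (hull rs) sel) :
  exists (n : nat) (out : set (set 'rV[R]_d)), algorithm_returns rs sel n out.
Proof.
case: d hd rs hrs hH sel hsel => // d _ rs _ hH sel hsel.
have [rho rho01 s_rho] := compact_interior_D_gap (hull_compact hk) hH.
set B := 2 ^+ d * (2 ^+ d.+1 * (1 - rho)^-1 ^+ d.+1) : R.
have B_le : B <= (Num.bound `|B|)%:~R.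
  exact: ltW (le_lt_trans (ler_norm B) (archi_boundP (normr_ge0 B))).
have finP : finite_set [set hull rs `&` P_ s | s in hull rs].
  apply: sub_finite_set
    (finite_image (setI (hull rs)) (finite_P_ R d.+1 (Num.bound `|B|))).
  move=> _ [s Hs <-]; exists (P_ s) => //; exists s => // a sa i.
  rewrite -(ler_int R); apply: le_trans B_le.
  exact: (witnesses_bounded rho01 (fun z => s_rho s z Hs) sa).
have [n ends] := loop_terminates finP hsel.
by exists n; eexists; split; first exact: ends.
Qed.
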